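(* Let $\overline{V}$ be an $n$-dimensional Minkowski space with Finsler metric $F^2$ and let $\overline{\overline{e}}=(\overline e_1,\dots,\overline e_n)$ be an orthonormal basis of $\overline V$. Let $g_{ij}$ denote the coordinates of the metric tensor relative to the basis $\overline{\overline e}$. Then the $n\times n$ matrix $$\begin{pmatrix} g_{11}(\overline e_1) & \dots & g_{1n}(\overline e_1)\\ \dots & \dots & \dots\\ g_{n1}(\overline e_n) & \dots & g_{nn}(\overline e_n)\end{pmatrix},$$ whose entry in row $k$ and column $l$ is $g_{kl}(\overline e_k)$, is a triangular matrix whose diagonal elements are either $1$ or $-1$.
   Context: A Minkowski space is a finite-dimensional real vector space $\overline V$ with a Finsler structure $F$ such that: (1) the Finsler metric $F^2:\overline V\to\mathbb R$ is real valued, not necessarily positive definite, and sufficiently differentiable at nonzero vectors ($F(\overline v)$ is a nonnegative real number if $F^2(\overline v)\ge 0$ and a positive imaginary number if $F^2(\overline v)<0$); (2) $F(a\overline x)=aF(\overline x)$ for $a>0$; (3) relative to a basis, the coordinates of the metric tensor $g_{ij}(\overline v)=\frac12\frac{\partial^2F^2(\overline v)}{\partial v^i\partial v^j}$, $\overline v\ne 0$, form a nonsingular symmetric matrix. Summation over repeated coordinate indices $i,j$ is understood. A vector $\overline w$ is orthogonal to $\overline v$ if $g_{ij}(\overline v)v^iw^j=0$ (this relation need not be symmetric). An ordered set $\overline e_1,\dots,\overline e_p$ is orthogonal if $g_{ij}(\overline e_k)e_k^ie_k^j\neq0$ for all $k$ and $g_{ij}(\overline e_k)e_k^ie_l^j=0$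 for all $k<l$. A basis is orthonormal if it is orthogonal and its vectors have unit length, i.e. $|F(\overline e_k)|=1$. *)

(* Defs.v *)
From HB Require Import structures.
From mathcomp Require Import all_boot all_order all_algebra.
From mathcomp Require Import complex.
From mathcomp Require Import all_classical all_reals all_analysis.

Set Implicit Arguments.
Unset Strict Implicit.
Unset Printing Implicit Defensive.

Import Order.TTheory GRing.Theory Num.Theory.
Import numFieldNormedType.Exports.

Local Open Scope classical_set_scope.
Local Open Scope ring_scope.
Local Open Scope complex_scope.

Definition vec_of (R : realType) (V : vectType R) (n : nat)
    (b : n.-tuple V) (x : 'rV[R]_n) : V :=
  \sum_(i < n) x 0 i *: tnth b i.

Definition coords (R : realType) (V : vectType R) (n : nat)
    (b : n.-tuple V) (v : V) : 'rV[R]_n :=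
  \row_(i < n) coord b i v.

(* F^2 as a real function; no information is lost under [is_minkowski], which
   requires F v ^+ 2 to be real. *)
Definition finsler_metric (R : realType) (V : vectType R) (F : V -> R[i])
    (v : V) : R :=
  complex.Re (F v ^+ 2).

(* The function (v^1, ..., v^n) |-> F^2(v) of the coordinates relative to b. *)
Definition coord_metric (R : realType) (V : vectType R) (n : nat)
    (b : n.-tuple V) (F : V -> R[i]) (x : 'rV[R]_n) : R :=
  finsler_metric F (vec_of b x).

Definition partial (R : realType) (n : nat) (i : 'I_n) (f : 'rV[R]_n -> R) :
    'rV[R]_n -> R :=
  'D_(delta_mx 0 i) f.

(* g_ij(v) = 1/2 d^2 F^2 (v) / dv^i dv^j relative to the basis b; meaningful
   for v != 0 only. *)
Definition metric_tensor (R : realType) (V : vectType R) (n : nat)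
    (b : n.-tuple V) (F : V -> R[i]) (v : V) : 'M[R]_n :=
  \matrix_(i < n, j < n)
    (2^-1 * partial i (partial j (coord_metric b F)) (coords b v)).

(* "Sufficiently differentiable at nonzero vectors" is read as C^2, the least
   regularity for which the metric tensor is continuous. *)
Definition C2_off_origin (R : realType) (n : nat) (f : 'rV[R]_n -> R) : Prop :=
  forall x : 'rV[R]_n, x != 0 ->
    [/\ differentiable f x,
        forall i : 'I_n, differentiable (partial i f) x
      & forall i j : 'I_n, {for x, continuous (partial i (partial j f))}].

(* F is a Finsler structure making V a Minkowski space.  The regularity of F^2
   and the nonsingularity and symmetry of g do not depend on the basis b in
   which they are expressed.  In the partial order of R[i], 0 <= z (z < 0)
   means that z is a nonnegative (negative) real number. *)
Record is_minkowski (R : realType) (V : vectType R) (n : nat)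
    (b : n.-tuple V) (F : V -> R[i]) : Prop := IsMinkowski {
  minkowski_real : forall v : V, F v ^+ 2 \is Num.real;
  minkowski_nneg : forall v : V, 0 <= F v ^+ 2 -> 0 <= F v;
  minkowski_neg : forall v : V, F v ^+ 2 < 0 ->
    exists2 y : R, 0 < y & F v = (0 +i* y)%C;
  minkowski_C2 : C2_off_origin (coord_metric b F);
  minkowski_homog : forall (a : R) (v : V), 0 < a ->
    F (a *: v) = a%:C * F v;
  minkowski_sym : forall v : V, v != 0 ->
    (metric_tensor b F v)^T = metric_tensor b F v;
  minkowski_nonsing : forall v : V, v != 0 ->
    metric_tensor b F v \in unitmx
}.

(* g_ij(v) v^i w^j *)
Definition metric_at (R : realType) (V : vectType R) (n : nat)
    (b : n.-tuple V) (F : V -> R[i]) (v w : V) : R :=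
  \sum_(i < n) \sum_(j < n)
    metric_tensor b F v i j * coords b v 0 i * coords b w 0 j.

(* "w is orthogonal to v"; not symmetric in v and w. *)
Definition orthogonal_to (R : realType) (V : vectType R) (n : nat)
    (b : n.-tuple V) (F : V -> R[i]) (w v : V) : Prop :=
  metric_at b F v w = 0.

Definition orthogonal_set (R : realType) (V : vectType R) (n : nat)
    (b : n.-tuple V) (F : V -> R[i]) (p : nat) (e : p.-tuple V) : Prop :=
  (forall k : 'I_p, metric_at b F (tnth e k) (tnth e k) != 0) /\
  (forall k l : 'I_p, (k < l)%N -> orthogonal_to b F (tnth e l) (tnth e k)).

Definition orthonormal_basis (R : realType) (V : vectType R) (n : nat)
    (b : n.-tuple V) (F : V -> R[i]) (e : n.-tuple V) : Prop :=
  [/\ basis_of fullv e, orthogonal_set b F e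
    & forall k : 'I_n, `|F (tnth e k)| = 1].

(* Main.v *)
(* The Hessian of F^2 is a bilinear form transforming by the transition matrix
   under a change of basis, so the entry g_kl(e_k) relative to e is the value of
   the metric at e_k on (e_k, e_l), which vanishes for k < l by orthogonality.
   On the diagonal no change of basis is needed: F^2 is quadratic along the ray
   of e_k, so g_kk(e_k) = F^2(e_k), a real number of modulus 1. *)
Require Import Defs.
From HB Require Import structures.
From mathcomp Require Import all_boot all_order all_algebra.
From mathcomp Require Import complex.
From mathcomp Require Import all_classical all_reals all_analysis.
From mathcomp Require Import ring.

Import Order.TTheory GRing.Theory Num.Theory.
Import numFieldNormedType.Exports.

Local Open Scope ring_scope.
Local Open Scope complex_scope.

(** The two difference quotients coincide, which reduces derivatives along a ray to calculus in one
    variable. *)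
Lemma derive_along_line {R : realType} {V W : normedModType R} (f : V -> W)
    (v : V) (a : R) :
  'D_v f (a *: v) = 'D_1 (fun t : R => f (t *: v)) a.
Proof.
rewrite /derive.
set p := (X in fmap X); set q := (X in _ = lim (fmap X _)).
suff -> : p = q by []. by apply/funext => h; rewrite /p /q /= scalerDl -scalerA scale1r.
Qed.

(** Euler's identity on the ray of [v], obtained by differentiating [t ^+ 2 * f v] in [t]. *)
Lemma derive_homog2 {R : realType} {V : normedModType R} (f : V -> R) (v : V) :
    (forall t : R, 0 < t -> f (t *: v) = t ^+ 2 * f v) ->
  forall t : R, 0 < t -> 'D_v f (t *: v) = t * (2 * f v).
Proof.
move=> fH t t0; rewrite derive_along_line.
(* Homogeneity holds for positive scalars only, but these fill a neighbourhood of [t > 0]. *)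
rewrite (near_eq_derive (g := fun s : R => s ^+ 2 * f v)); last first.
  by near=> s; apply: fH; near: s; exact: lt_nbhsr.
have -> : (fun s : R => s ^+ 2 * f v) = f v \*: (fun s : R => s ^+ 2).
  by apply/funext => s /=; rewrite mulrC.
rewrite deriveZ // exp_derive expr1 /GRing.scale /= mulr1; ring.
Unshelve. all: by end_near.
Qed.

(** The first derivative is linear along the ray, with slope [2 * f v]; it is differentiated at
    parameter 1. *)
Lemma derive2_homog2 {R : realType} {V : normedModType R} (f : V -> R) (v : V) :
    (forall t : R, 0 < t -> f (t *: v) = t ^+ 2 * f v) ->
  'D_v ('D_v f) v = 2 * f v.
Proof.
move=> fH; have := derive_along_line ('D_v f) v 1; rewrite scale1r => ->.
rewrite (near_eq_derive (g := fun s : R => s * (2 * f v))); last first.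
  by near=> s; apply: derive_homog2 => //; near: s; exact: lt_nbhsr.
have -> : (fun s : R => s * (2 * f v)) = (2 * f v) \*: id.
  by apply/funext => s /=; rewrite mulrC.
by rewrite deriveZ // derive_id scaler1.
Unshelve. all: by end_near.
Qed.

Lemma derive_mulmxr {R : realType} {m n : nat} (f : 'rV[R]_n -> R)
    (A : 'M[R]_(m, n)) (x v : 'rV[R]_m) :
  'D_v (fun y => f (y *m A)) x = 'D_(v *m A) f (x *m A).
Proof.
rewrite /derive.
set p := (X in fmap X); set q := (X in _ = lim (fmap X _)).
suff -> : p = q by []. by apply/funext => h; rewrite /p /q /= mulmxDl -scalemxAl.
Qed.

Lemma derive_sum_partial {R : realType} {n : nat} (f : 'rV[R]_n -> R)
    (x v : 'rV[R]_n) :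
  differentiable f x -> 'D_v f x = \sum_(i < n) v 0 i * partial i f x.
Proof.
move=> df; rewrite deriveE // {1}[v]row_sum_delta linear_sum.
by apply: eq_bigr => i _; rewrite linearZ /partial deriveE.
Qed.

(** Transformation rule of the Hessian: each differentiation in a coordinate direction becomes one
    along a row of [A]. Injectivity of [A] keeps the argument of [f] away from the origin. *)
Lemma partial2_mulmxr {R : realType} {n : nat} (f : 'rV[R]_n -> R)
    (A : 'M[R]_n) (k l : 'I_n) (x : 'rV[R]_n) :
    C2_off_origin f -> row_free A -> x != 0 ->
  partial k (partial l (fun y => f (y *m A))) x =
  \sum_(i < n) \sum_(j < n)
     A k i * A l j * partial i (partial j f) (x *m A).
Proof.
move=> fC2 Afree x0.
have nz (y : 'rV[R]_n) : y != 0 -> y *m A != 0.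
  by apply: contra => /eqP yA0; apply/eqP/(row_free_inj Afree); rewrite mul0mx.
have deltaA i : delta_mx 0 i *m A = row i A by rewrite rowE.
have [_ dpf _] := fC2 _ (nz _ x0).
pose g (z : 'rV[R]_n) := \sum_(j < n) A l j * partial j f z.
(* The inner partial derivative is expanded at nonzero points only; these form a neighbourhood of
   [x], which suffices for the outer one. *)
rewrite {1}/partial (near_eq_derive (g := fun y => g (y *m A))); last first.
  have: (\forall y \near x, y != 0)%classic by exact: cvgr_neq0 cvg_id x0.
  apply: filterS => y y0.
  rewrite /partial derive_mulmxr derive_sum_partial.
    by apply: eq_bigr => j _; rewrite deltaA mxE.
  by have [] := fC2 _ (nz _ y0).
rewrite derive_mulmxr.
have -> : g = \sum_(j < n) (A l j \*: partial j f).
  by apply/funext => z; rewrite fct_sumE.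
rewrite derive_sum; last by move=> j; apply: derivableZ; exact: diff_derivable.
rewrite exchange_big /=; apply: eq_bigr => j _.
rewrite deriveZ; last exact: diff_derivable.
rewrite derive_sum_partial // deltaA scaler_sumr.
by apply: eq_bigr => i _; rewrite mxE /GRing.scale /= mulrA [A l j * _]mulrC.
Qed.

Section ChangeOfBasis.
Context {R : realType} {V : vectType R} {n : nat} {b e : n.-tuple V}.
Hypotheses (b_basis : basis_of fullv b) (e_basis : basis_of fullv e).

Lemma coords_vec_of (x : 'rV[R]_n) : coords e (vec_of e x) = x.
Proof.
apply/rowP => i; rewrite mxE /vec_of linear_sum (bigD1 i) //= linearZ /=.
rewrite (tnth_nth 0) coord_free ?(basis_free e_basis) // eqxx mulr1.
rewrite big1 ?addr0 // => j /negPf ji.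
by rewrite linearZ /= (tnth_nth 0) coord_free ?(basis_free e_basis) // ji mulr0.
Qed.

Lemma vec_of_delta (k : 'I_n) : vec_of e (delta_mx 0 k) = tnth e k.
Proof.
rewrite /vec_of (bigD1 k) //= mxE !eqxx scale1r big1 ?addr0 // => j /negPf jk.
by rewrite mxE jk andbF scale0r.
Qed.

Lemma coords_tnth (k : 'I_n) : coords e (tnth e k) = delta_mx 0 k.
Proof. by rewrite -vec_of_delta coords_vec_of. Qed.

(** Coordinates are row vectors, so multiplication by this matrix on the right turns coordinates
    relative to [e] into coordinates relative to [b]. *)
Definition transition_mx : 'M[R]_n := \matrix_(k < n) coords b (tnth e k).

Lemma vec_of_transition (x : 'rV[R]_n) :
  vec_of e x = vec_of b (x *m transition_mx).
Proof.
rewrite /vec_of; under [RHS]eq_bigr => i _ do rewrite mxE scaler_suml.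
rewrite exchange_big; apply: eq_bigr => k _ /=.
rewrite {1}(coord_basis b_basis (memvf (tnth e k))) scaler_sumr.
by apply: eq_bigr => i _; rewrite !mxE scalerA -tnth_nth.
Qed.

(** A row killed by the matrix represents the zero vector in [e], so its coordinates vanish. *)
Lemma transition_free : row_free transition_mx.
Proof.
apply/inj_row_free => x xA0.
rewrite -[x]coords_vec_of vec_of_transition xA0 /vec_of big1 => [|i _].
  by apply/rowP => i; rewrite !mxE linear0.
by rewrite mxE scale0r.
Qed.

Lemma metric_tensor_at (F : V -> R[i]) (k l : 'I_n) :
    C2_off_origin (coord_metric b F) ->
  metric_tensor e F (tnth e k) k l = metric_at b F (tnth e k) (tnth e l).
Proof.
move=> C2.
have coord_metricE : coord_metric e F =
    fun y => coord_metric b F (y *m transition_mx).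
  by apply/funext => y; rewrite /coord_metric vec_of_transition.
rewrite mxE coords_tnth coord_metricE.
rewrite partial2_mulmxr //; first last.
- apply/eqP => /matrixP/(_ 0 k); rewrite !mxE !eqxx => /eqP.
  by rewrite oner_eq0.
- exact: transition_free.
(* The point of evaluation is row [k] of the transition matrix, that is, the coordinates of
   [tnth e k] in [b]. *)
rewrite -rowE rowK mulr_sumr; apply: eq_bigr => i _.
rewrite mulr_sumr; apply: eq_bigr => j _.
by rewrite !mxE [_ * partial _ _ _]mulrC !mulrA.
Qed.

(** Both derivatives are taken at [delta_mx 0 k] in its own direction, so the factor 2 from
    homogeneity of degree two cancels the [2^-1]. *)
Lemma metric_tensor_diag (F : V -> R[i]) (k : 'I_n) :
    (forall (a : R) (v : V), 0 < a -> F (a *: v) = a%:C * F v) ->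
  metric_tensor e F (tnth e k) k k = finsler_metric F (tnth e k).
Proof.
move=> FH; rewrite mxE coords_tnth /partial derive2_homog2.
  by rewrite /coord_metric vec_of_delta mulrA mulVf ?mul1r // pnatr_eq0.
move=> t t0; rewrite /coord_metric.
have -> : vec_of e (t *: delta_mx 0 k) = t *: vec_of e (delta_mx 0 k).
  by rewrite /vec_of scaler_sumr; apply: eq_bigr => i _; rewrite mxE scalerA.
rewrite /finsler_metric FH // exprMn -rmorphXn /=.
(* The factor [t ^+ 2] is real, so it comes out of the real part. *)
by case: (F _ ^+ 2) => x y /=; rewrite mul0r subr0.
Qed.

End ChangeOfBasis.

Lemma Re_sqr_norm1 {R : realType} (z : R[i]) :
  z ^+ 2 \is Num.real -> `|z| = 1 ->
  complex.Re (z ^+ 2) = 1 \/ complex.Re (z ^+ 2) = -1.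
Proof.
move=> zR z1.
have : `|z ^+ 2| = 1 by rewrite normrX z1 expr1n.
case: (real_ge0P zR) => _ => [->|/eqP]; first by left.
by rewrite eqr_oppLR => /eqP ->; right.
Qed.

Theorem theorem2p3p8 (R : realType) (n : nat) (V : vectType R)
    (b : n.-tuple V) (F : V -> R[i]) (e : n.-tuple V)
    (dimV : \dim (fullv : {vspace V}) = n)
    (b_basis : basis_of fullv b)
    (minkF : is_minkowski b F)
    (e_onb : orthonormal_basis b F e) :
  let M : 'M[R]_n := \matrix_(k < n, l < n) metric_tensor e F (tnth e k) k l in
  is_trig_mx M /\ forall k : 'I_n, M k k = 1 \/ M k k = -1.
Proof.
case: minkF => Freal _ _ FC2 Fhomog _ _.
case: e_onb => e_basis [_ e_orth] e_unit; split.
  (* [is_trig_mx] means lower triangular: the entries to kill have [k < l], exactly the pairs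
     covered by [orthogonal_set]. *)
  apply/is_trig_mxP => k l kl; rewrite mxE (metric_tensor_at b_basis e_basis) //.
  exact: e_orth.
move=> k; rewrite mxE (metric_tensor_diag e_basis) //.
exact: Re_sqr_norm1.
Qed.
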